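(* Let $(R,\mathfrak{m})$ be a commutative Noetherian local ring, $\mathcal{S}$ a Serre class of $R$-modules, $M$ a finitely generated $\mathcal{S}$-Cohen-Macaulay $R$-module, and $x\in\mathfrak{m}$ a weak $M$-sequence (of length one) with respect to $\mathcal{S}$. If $\mathcal{S}\text{-}\mathrm{Assh}_R(M/xM)\ne\emptyset$, then $M/xM$ is an $\mathcal{S}$-Cohen-Macaulay $R$-module.
   Context: A Serre class $\mathcal{S}$ of $R$-modules is a (nonempty) class of $R$-modules such that for every exact sequence $0\to L\to M\to N\to 0$ of $R$-modules, $M\in\mathcal{S}$ if and only if $L\in\mathcal{S}$ and $N\in\mathcal{S}$. A sequence $x_1,\dots,x_r$ in $R$ is a weak $M$-sequence with respect to $\mathcal{S}$ if for each $i=1,\dots,r$ the module $((x_1,\dots,x_{i-1})M:_M x_i)/(x_1,\dots,x_{i-1})M$ belongs to $\mathcal{S}$, where $(N:_M x)=\{m\in M: xm\in N\}$; thus a single element $x$ is a weak $M$-sequence with respect to $\mathcal{S}$ iff $(0:_M x)\in\mathcal{S}$. A finitely generated module $M$ over a local ring is $\mathcal{S}$-Cohen-Macaulay if every system of parameters of $M$ is a weak $M$-sequence with respect to $\mathcal{S}$. For an $R$-module $L$: $\mathcal{S}\text{-}\mathrm{Supp}_R(L)=\{\mathfrak{p}\in\mathrm{Supp}_R L: R/\mathfrak{p}\notin\mathcal{S}\}$ and $\mathcal{S}\text{-}\mathrm{Assh}_R(L)=\{\mathfrak{p}\in\mathcal{S}\text{-}\mathrm{Supp}_R(L):\dim(R/\mathfrak{p})=\dim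 L\}$. *)

(* Defs.v *)
From HB Require Import structures.
From mathcomp Require Import all_boot all_order all_algebra.
From mathcomp Require Import generic_quotient ring_quotient.
From mathcomp Require Import boolp constructive_ereal.

Set Implicit Arguments.
Unset Strict Implicit.
Unset Printing Implicit Defensive.

Import GRing.Theory.
Local Open Scope ring_scope.
Local Open Scope quotient_scope.

Section Submodules.
Variables (R : comNzRingType) (M : lmodType R).

Record submod_of (N : submodClosed M) := Submod {
  submod_val : M;
  submod_valP : submod_val \in N }.

HB.instance Definition _ (N : submodClosed M) :=
  [isSub for @submod_val N].
HB.instance Definition _ (N : submodClosed M) :=
  [Choice of submod_of N by <:].
HB.instance Definition _ (N : submodClosed M) :=
  [SubChoice_isSubLmodule of submod_of N by <:].

Section Quotient.
Variable N : submodClosed M.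

(* [submodClosed] does not inherit from [zmodClosed] in the library, so [N] is
   repackaged to reuse the quotient of Z-modules *)
Definition subzmod : {pred M} := [pred u | u \in N].

Lemma subzmod_closed : zmod_closed subzmod.
Proof. exact: submodClosedP. Qed.

HB.instance Definition _ := GRing.isZmodClosed.Build M subzmod subzmod_closed.

Definition quotmod : Type := Quotient.quot subzmod.

HB.instance Definition _ := GRing.Zmodule.on quotmod.

Definition quotmod_pi (u : M) : quotmod := \pi_(Quotient.quot subzmod) u.
Definition quotmod_scale (a : R) (u : quotmod) : quotmod :=
  quotmod_pi (a *: repr (u : Quotient.quot subzmod)).

Lemma quotmod_piE u v : (quotmod_pi u = quotmod_pi v) <-> (u - v \in N).
Proof.
rewrite -[u - v \in N]/(u - v \in subzmod) Quotient.idealrBE.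
by split=> [eq_uv|/eqP]; first exact/eqP.
Qed.

Lemma quotmod_piP (u : quotmod) : exists v, u = quotmod_pi v.
Proof. by exists (repr (u : Quotient.quot subzmod)); rewrite /quotmod_pi reprK. Qed.

Lemma quotmod_piD u v : quotmod_pi (u + v) = quotmod_pi u + quotmod_pi v.
Proof. exact: Quotient.pi_add. Qed.

Lemma quotmod_scale_pi a u :
  quotmod_scale a (quotmod_pi u) = quotmod_pi (a *: u).
Proof.
apply/quotmod_piE; rewrite -scalerBr rpredZ //; apply/quotmod_piE.
by rewrite /quotmod_pi reprK.
Qed.

Lemma quotmod_scalerA a b u :
  quotmod_scale a (quotmod_scale b u) = quotmod_scale (a * b) u.
Proof. by have [v ->] := quotmod_piP u; rewrite !quotmod_scale_pi scalerA. Qed.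

Lemma quotmod_scale1r : left_id 1 quotmod_scale.
Proof.
by move=> u; have [v ->] := quotmod_piP u; rewrite quotmod_scale_pi scale1r.
Qed.

Lemma quotmod_scalerDr : right_distributive quotmod_scale +%R.
Proof.
move=> a u v; have [u' ->] := quotmod_piP u; have [v' ->] := quotmod_piP v.
by rewrite -quotmod_piD !quotmod_scale_pi scalerDr quotmod_piD.
Qed.

Lemma quotmod_scalerDl u :
  {morph quotmod_scale^~ u : a b / a + b}.
Proof.
move=> a b; have [v ->] := quotmod_piP u.
by rewrite !quotmod_scale_pi scalerDl quotmod_piD.
Qed.

HB.instance Definition _ := GRing.Zmodule_isLmodule.Build R quotmod
  quotmod_scalerA quotmod_scale1r quotmod_scalerDr quotmod_scalerDl.

End Quotient.

End Submodules.

Section SubQuotient.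
Variables (R : comNzRingType) (M : lmodType R).
Variables K N : submodClosed M.

Definition subpreim : {pred submod_of K} := [pred u | submod_val u \in N].

Lemma subpreim_closed : submod_closed subpreim.
Proof.
split=> [|a u v]; rewrite !inE ?rpred0 // => uN vN.
by rewrite rpredD // rpredZ.
Qed.

HB.instance Definition _ :=
  GRing.isSubmodClosed.Build R (submod_of K) subpreim subpreim_closed.

(* K / N, meant for N contained in K *)
Definition subquot : lmodType R := quotmod subpreim.

End SubQuotient.

Section Constructions.
Variables (R : comNzRingType) (M : lmodType R).

Section SeqMul.
Variable xs : seq R.

(* (x_1, ..., x_r) M *)
Definition seqmul : {pred M} :=
  [pred u | `[< exists f : 'I_(size xs) -> M, u = \sum_(i < size xs) xs`_i *: f i >]].

Lemma seqmul_closed : submod_closed seqmul.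
Proof.
split=> [|a u v].
  by apply/asboolP; exists (fun=> 0); rewrite big1 // => i _; rewrite scaler0.
move=> /asboolP[f ->] /asboolP[g ->]; apply/asboolP.
exists (fun i => a *: f i + g i); rewrite scaler_sumr -big_split /=.
by apply: eq_bigr => i _; rewrite scalerDr !scalerA mulrC.
Qed.

HB.instance Definition _ :=
  GRing.isSubmodClosed.Build R M seqmul seqmul_closed.

End SeqMul.

Section Colon.
Variables (N : submodClosed M) (x : R).

(* N :_M x *)
Definition colon : {pred M} := [pred u | x *: u \in N].

Lemma colon_closed : submod_closed colon.
Proof.
split=> [|a u v]; rewrite !inE ?scaler0 ?rpred0 // => uN vN.
by rewrite scalerDr scalerA mulrC -scalerA rpredD // rpredZ.
Qed.

HB.instance Definition _ :=
  GRing.isSubmodClosed.Build R M colon colon_closed.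

End Colon.

Definition fin_gen : Prop :=
  exists s : seq M, forall u : M,
    exists c : 'I_(size s) -> R, u = \sum_(i < size s) c i *: s`_i.

Definition covers (N K : submodClosed M) : Prop :=
  [/\ {subset N <= K}, ~ {subset K <= N} &
      forall L : submodClosed M, {subset N <= L} -> {subset L <= K} ->
        L =i N \/ L =i K].

(* existence of a composition series *)
Definition finite_length : Prop :=
  exists (n : nat) (N : nat -> submodClosed M),
    [/\ N 0%N =i [pred u | u == 0], N n =i predT &
        forall i, (i < n)%N -> covers (N i) (N i.+1)].

End Constructions.

Arguments quotmod {R M} N.
Arguments subquot {R M} K N.
Arguments seqmul {R} M xs.
Arguments fin_gen {R} M.
Arguments finite_length {R} M.

Section Rings.
Variable R : comNzRingType.

Definition noetherian : Prop :=
  forall I : submodClosed (R^o : lmodType R), fin_gen (submod_of I).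

Definition maximal_ideal (I : idealr R) : Prop :=
  forall J : idealr R, {subset I <= J} -> J =i I.

Definition local_ring (m : idealr R) : Prop :=
  maximal_ideal m /\ forall J : idealr R, maximal_ideal J -> J =i m.

Section ModIdeal.
Variable p : idealr R.

Definition ideal_pred : {pred (R^o : lmodType R)} := [pred a | (a : R) \in p].

Lemma ideal_pred_closed : submod_closed ideal_pred.
Proof.
split=> [|a u v]; rewrite !inE ?rpred0 // => uN vN.
by rewrite rpredD // idealMr.
Qed.

HB.instance Definition _ :=
  GRing.isSubmodClosed.Build R (R^o : lmodType R) ideal_pred ideal_pred_closed.

(* R / p as an R-module *)
Definition ring_mod : lmodType R := quotmod ideal_pred.

End ModIdeal.

(* equality u / s = v / t of fractions in the localization M_p *)
Definition frac_eq (M : lmodType R) (p : prime_idealr R) (u : M) (s : R)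
    (v : M) (t : R) : Prop :=
  exists2 w : R, w \notin p & w *: (t *: u - s *: v) = 0.

(* p belongs to Supp M, i.e. M_p has a nonzero element u / s *)
Definition supp (M : lmodType R) (p : prime_idealr R) : Prop :=
  exists (u : M) (s : R), s \notin p /\ ~ frac_eq p u s 0 1.

Definition supp_chain (M : lmodType R) (n : nat) : Prop :=
  exists p : nat -> prime_idealr R,
    (forall i, (i <= n)%N -> supp M (p i)) /\
    (forall i, (i < n)%N ->
       {subset p i <= p i.+1} /\ ~ {subset p i.+1 <= p i}).

(* supremum of the lengths of chains of primes in Supp M; -oo if M = 0 *)
Definition krull_dim (M : lmodType R) : \bar nat :=
  match pselect (exists n, supp_chain M n /\
                   forall k, supp_chain M k -> (k <= n)%N) with
  | left e => (projT1 (cid e))%:E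
  | right _ => if `[< exists n, supp_chain M n >] then +oo%E else -oo%E
  end.

Definition sop (m : idealr R) (M : lmodType R) (xs : seq R) : Prop :=
  [/\ krull_dim M = (size xs)%:E, {subset xs <= m} &
      finite_length (quotmod (seqmul M xs))].

Definition short_exact (L M N : lmodType R)
    (f : {linear L -> M}) (g : {linear M -> N}) : Prop :=
  [/\ injective f, forall v, exists u, g u = v &
      forall u, g u = 0 <-> exists w, f w = u].

Definition serre_class (S : lmodType R -> Prop) : Prop :=
  (exists M, S M) /\
  forall (L M N : lmodType R) (f : {linear L -> M}) (g : {linear M -> N}),
    short_exact f g -> (S M <-> S L /\ S N).

Definition weak_seq (S : lmodType R -> Prop) (M : lmodType R)
    (xs : seq R) : Prop :=
  forall i, (i < size xs)%N ->
    S (subquot (colon (seqmul M (take i xs)) xs`_i) (seqmul M (take i xs))).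

Definition S_CM (m : idealr R) (S : lmodType R -> Prop)
    (M : lmodType R) : Prop :=
  fin_gen M /\ forall xs : seq R, sop m M xs -> weak_seq S M xs.

Definition S_Supp (S : lmodType R -> Prop) (L : lmodType R)
    (p : prime_idealr R) : Prop :=
  supp L p /\ ~ S (ring_mod p).

Definition S_Assh (S : lmodType R -> Prop) (L : lmodType R)
    (p : prime_idealr R) : Prop :=
  S_Supp S L p /\ krull_dim (ring_mod p) = krull_dim L.

End Rings.

Arguments noetherian R : clear implicits.

(* Main.v *)
Require Import Defs.
From mathcomp Require Import all_boot all_order all_algebra.
From HB Require Import structures.
From mathcomp Require Import fingroup perm ring_quotient boolp constructive_ereal.
From mathcomp Require Import ring.

Set Implicit Arguments.
Unset Strict Implicit.
Unset Printing Implicit Defensive.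

Import GRing.Theory.
Local Open Scope ring_scope.

(** Let [r] be the dimension of [M / xM] and [ys] one of its systems of
    parameters, so that [M / (x, ys) M] has finite length and [ys] has [r]
    entries.

    If [dim M = r + 1], then [x :: ys] is a system of parameters of [M], hence
    a weak [M]-sequence, and dropping its first entry gives back the
    conditions that make [ys] a weak sequence on [M / xM], because the
    subquotients that occur on both sides are isomorphic
    ([weak_seq_quot], [finite_length_quot]).

    The dimension of [M] is at most [r + 1] ([supp_chain_quot]): by Krull's
    principal ideal theorem a chain of primes that ends in the maximal ideal
    can be rerouted so that [x] lies in all its members but the first
    ([prime_chain_through]), and the primes of [Supp M] that contain [x] form
    [Supp (M / xM)] by Nakayama's lemma ([supp_quot_fg]).

    In the remaining case [M] has no chain of length [r + 1]. A prime [p] in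
    [S-Assh (M / xM)] satisfies [dim R/p = r], so [p] is minimal in [Supp M]
    ([supp_chain_cons]), hence [p] is the annihilator of some [u] in [M]
    ([supp_minimal_ass]). As [x] lies in [p], it kills [u], so [R / p] embeds
    into [(0 :_M x)], which belongs to [S] because [x] is a weak [M]-sequence.
    Then [R / p] is in [S], contrary to the choice of [p].

    The principal ideal theorem is proved in the form [krull_height_two],
    without passing to quotient rings or localizations: an ideal of the local
    ring at [p] is represented by an ideal of [R] that is saturated with
    respect to the complement of [p]. *)

(** * Submodules given by propositions *)

Section Submodules.
Variables (R : comNzRingType) (M : lmodType R).

Definition submodule (P : M -> Prop) : Prop :=
  P 0 /\ forall a u v, P u -> P v -> P (a *: u + v).

Section Theory.
Variables (P : M -> Prop) (subP : submodule P).

Lemma submodule0 : P 0. Proof. by case: subP. Qed.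

Lemma submoduleZ a u : P u -> P (a *: u).
Proof. by move=> Pu; rewrite -[_ *: _]addr0; apply: subP.2 => //; case: subP. Qed.

Lemma submoduleD u v : P u -> P v -> P (u + v).
Proof. by move=> Pu Pv; rewrite -[u]scale1r; apply: subP.2. Qed.

Lemma submoduleB u v : P u -> P v -> P (u - v).
Proof.
by move=> Pu Pv; apply: submoduleD => //; rewrite -scaleN1r; apply: submoduleZ.
Qed.

Lemma submodule_sum (I : finType) (f : I -> M) :
  (forall i, P (f i)) -> P (\sum_i f i).
Proof.
by move=> Pf; elim/big_ind: _ => //; [apply: submodule0 | apply: submoduleD].
Qed.

(** The proof of closure is an argument so that the instance below can be
    found from the term alone. *)
Definition submodule_pred (_ : submodule P) : {pred M} := [pred u | `[<P u>]].

Lemma submodule_predP u : (u \in submodule_pred subP) <-> P u.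
Proof. by split=> /asboolP. Qed.

Lemma submodule_pred_closed : submod_closed (submodule_pred subP).
Proof.
split=> [|a u v]; first exact/asboolP/submodule0.
by move=> /asboolP Pu /asboolP Pv; apply/asboolP; apply: subP.2.
Qed.

End Theory.

HB.instance Definition _ P (subP : submodule P) :=
  GRing.isSubmodClosed.Build R M (submodule_pred subP)
    (submodule_pred_closed subP).

Lemma submodule_mem (N : submodClosed M) : submodule (fun u => u \in N).
Proof. by split=> [|a u v uN vN]; rewrite ?rpred0 ?rpredD ?rpredZ. Qed.

Lemma submodule_eq0 : submodule (fun u : M => u = 0).
Proof. by split=> // a u v -> ->; rewrite scaler0 addr0. Qed.

End Submodules.

(** * Ideals, primes and saturation *)

Section Primes.
Variable R : comNzRingType.
Implicit Types (p q : prime_idealr R) (I J : R -> Prop).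

Definition ideal I : Prop := submodule (I : R^o -> Prop).

Definition prime_lt p q : Prop := {subset p <= q} /\ ~ {subset q <= p}.

Lemma ideal_mem (p : idealr R) : ideal (fun a => a \in p).
Proof. by split=> [|a u v up vp]; rewrite ?idealr0 ?rpredD ?idealMr. Qed.

Lemma idealM I (idI : ideal I) a u : I u -> I (a * u).
Proof. exact: (submoduleZ idI). Qed.

Lemma ideal_idealr I : ideal I -> ~ I 1 ->
  exists q : idealr R, forall u, u \in q <-> I u.
Proof.
move=> idI I1.
pose S : {pred R} := [pred u | `[<I u>]].
have clS : idealr_closed S.
  split; [exact/asboolP/(submodule0 idI) | by apply/asboolP |].
  by move=> a u v /asboolP Iu /asboolP Iv; apply/asboolP; apply: idI.2.
pose f := isIdealr.Build R S clS.
pose Q : idealr R := HB.pack (S : R -> bool) f.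
by exists Q => u; split=> [/asboolP|Iu] //; apply/asboolP.
Qed.

Lemma ideal_prime I : ideal I -> ~ I 1 ->
    (forall a b, I (a * b) -> I a \/ I b) ->
  exists q, forall u, u \in q <-> I u.
Proof.
move=> idI I1 prI.
pose S : {pred R} := [pred u | `[<I u>]].
have clS : idealr_closed S.
  split; [exact/asboolP/(submodule0 idI) | by apply/asboolP |].
  by move=> a u v /asboolP Iu /asboolP Iv; apply/asboolP; apply: idI.2.
have prS : prime_idealr_closed S.
  by move=> a b /asboolP/prI[] ?; apply/orP; [left|right]; apply/asboolP.
pose f := isIdealr.Build R S clS.
pose g := isPrimeIdealrClosed.Build R S prS.
pose Q : prime_idealr R := HB.pack (S : R -> bool) f g.
by exists Q => u; split=> [/asboolP|Iu] //; apply/asboolP.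
Qed.

Lemma notin_primeM p a b : a \notin p -> b \notin p -> a * b \notin p.
Proof. by rewrite prime_idealrM negb_or => -> ->. Qed.

Lemma notin_prime1 p : 1 \notin p.
Proof. by rewrite idealr1. Qed.

Lemma notin_prime_prod p (I : finType) (f : I -> R) :
  (forall i, f i \notin p) -> \prod_i f i \notin p.
Proof.
move=> fp; elim/big_ind: _ => //; [exact: notin_prime1 | exact: notin_primeM].
Qed.

Definition ideal_adjoin I a u : Prop := exists v r, I v /\ u = v + r * a.

Lemma ideal_adjoin_ideal I a : ideal I -> ideal (ideal_adjoin I a).
Proof.
move=> idI; split.
  by exists 0, 0; split; [exact: (submodule0 idI) | rewrite mul0r addr0].
move=> c _ _ [u1 [r1 [Iu1 ->]]] [u2 [r2 [Iu2 ->]]].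
exists (c * u1 + u2), (c * r1 + r2); split; first exact: (idI.2 c).
by rewrite /GRing.scale /= mulrDr mulrDl addrACA mulrA.
Qed.

Lemma ideal_adjoinl I a u : I u -> ideal_adjoin I a u.
Proof. by move=> Iu; exists u, 0; rewrite mul0r addr0. Qed.

Lemma ideal_adjoinr I a : ideal I -> ideal_adjoin I a a.
Proof. by move=> idI; exists 0, 1; rewrite mul1r add0r; split=> //; case: idI. Qed.

Lemma ideal_colon I a : ideal I -> ideal (fun u => I (u * a)).
Proof.
move=> idI; split; first by rewrite mul0r; case: idI.
move=> c u v Iu Iv; rewrite /GRing.scale /= mulrDl -mulrA.
exact: (idI.2 c).
Qed.

Definition saturated p I : Prop := forall s u, s \notin p -> I (s * u) -> I u.

(** The contraction of the extension of [I] to the local ring at [p]. *)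
Definition saturation p I u : Prop := exists2 s, s \notin p & I (s * u).

Lemma saturation_ideal p I : ideal I -> ideal (saturation p I).
Proof.
move=> idI; split.
  by exists 1; [exact: notin_prime1 | rewrite mulr0; case: idI].
move=> c u v [s sp Isu] [t tp Itv]; exists (s * t); first exact: notin_primeM.
have -> : s * t * (c *: (u : R^o) + v) = (t * c) * (s * u) + s * (t * v).
  by rewrite /GRing.scale /=; ring.
by apply: (submoduleD idI); apply: idealM.
Qed.

Lemma saturation_saturated p I : saturated p (saturation p I).
Proof.
move=> s u sp [t tp Itsu]; exists (t * s); first exact: notin_primeM.
by rewrite -mulrA.
Qed.

Lemma saturation_id p I u : I u -> saturation p I u.
Proof. by exists 1; [exact: notin_prime1 | rewrite mul1r]. Qed.

Lemma colon_saturated p I a :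
  saturated p I -> saturated p (fun u => I (u * a)).
Proof. by move=> satI s u sp; rewrite -mulrA; apply: satI. Qed.

End Primes.

(** * Nakayama's lemma at a prime *)

Section Nakayama.
Variables (R : comNzRingType) (p : prime_idealr R).

(** Modulo [p] the matrix is diagonal, and its diagonal entries are nonzero
    elements of an integral domain. *)
Lemma notin_prime_det n (B : 'M[R]_n) :
    (forall i, B i i \notin p) -> (forall i j, i != j -> B i j \in p) ->
  \det B \notin p.
Proof.
move=> Bii Bij; rewrite /determinant (bigD1 1%g) //=.
rewrite odd_perm1 expr0 mul1r (eq_bigr (fun i => B i i)); last first.
  by move=> i _; rewrite perm1.
set d := \prod_i _; set e := \sum_(_ | _) _.
suff ep : e \in p.
  apply: contra (notin_prime_prod Bii) => dep.
  by rewrite -/d -[d](addrK e) rpredB.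
apply: rpred_sum => s s1; apply: idealMr.
have [i si] : exists i, s i != i.
  apply/existsP; apply: contraNT s1; rewrite negb_exists => /forallP s_id.
  by apply/eqP/permP=> i; rewrite perm1; apply/eqP; rewrite -[_ == _]negbK.
by rewrite (bigD1 i) //= mulrC idealMr // Bij // eq_sym.
Qed.

(** Nakayama's lemma for the localization at [p] of the submodule generated
    by [s], relative to [K]: if [<s>] is contained in [K + p <s>] after
    localizing, then it is contained in [K] after localizing. The
    denominators form one system of linear relations [B s = 0] modulo [K],
    with [B] diagonal modulo [p], and the adjugate of [B] turns it into
    [det B s = 0] modulo [K]. *)
Lemma local_nakayama (M : lmodType R) (K : M -> Prop) (s : seq M) :
    submodule K ->
    (forall i : 'I_(size s), exists (t : R) (a : 'I_(size s) -> R),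
       [/\ t \notin p, forall j, a j \in p &
           K (t *: s`_i - \sum_j a j *: s`_j)]) ->
  exists2 t : R, t \notin p & forall i : 'I_(size s), K (t *: s`_i).
Proof.
move=> subK /choice[t /choice[a tas]].
pose B : 'M[R]_(size s) := \matrix_(i, j) (t i *+ (i == j) - a i j).
have BE i j : B i j = t i *+ (i == j) - a i j by rewrite mxE.
exists (\det B).
  apply: notin_prime_det => [i|i j ij].
    rewrite BE eqxx; have [ti ap _] := tas i.
    by apply: contra ti => tap; rewrite -[t i](subrK (a i i)) rpredD.
  rewrite BE (negPf ij) mulr0n sub0r rpredN.
  by have [] := tas i.
have KB i : K (\sum_j B i j *: s`_j).
  have [_ _] := tas i; congr K; rewrite [RHS](eq_bigr (fun j =>
    (t i *+ (i == j)) *: s`_j - a i j *: s`_j)); last first.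
    by move=> j _; rewrite BE scalerBl.
  rewrite sumrB; congr (_ - _); rewrite (bigD1 i) //= eqxx big1 ?addr0 // => j.
  by rewrite eq_sym => /negPf->; rewrite scale0r.
move=> k.
have -> : \det B *: s`_k = \sum_i (\adj B) k i *: \sum_j B i j *: s`_j.
  under eq_bigr do rewrite scaler_sumr.
  rewrite exchange_big /=.
  under eq_bigr do (under eq_bigr do rewrite scalerA; rewrite -scaler_suml).
  rewrite (eq_bigr (fun j => (\det B *+ (k == j)) *: s`_j)) => [|j _]; last first.
    by have /matrixP/(_ k j) := mul_adj_mx B; rewrite !mxE => <-.
  rewrite (bigD1 k) //= eqxx big1 ?addr0 // => j.
  by rewrite eq_sym => /negPf->; rewrite scale0r.
by apply: (submodule_sum subK) => i; apply: submoduleZ.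
Qed.

End Nakayama.

(** * Noetherian rings and Krull's principal ideal theorem *)

Section Noetherian.
Variables (R : comNzRingType) (R_noeth : noetherian R).
Implicit Types (p q : prime_idealr R) (I J : R -> Prop).

Lemma ideal_fg I : ideal I -> exists s : seq R,
  (forall i : 'I_(size s), I s`_i) /\
  forall u, I u -> exists c : 'I_(size s) -> R, u = \sum_i c i * s`_i.
Proof.
move=> idI; have [s gen_s] := R_noeth (submodule_pred idI).
pose f := fun w : submod_of (submodule_pred idI) => submod_val w : R.
have nth_f i : (map f s)`_i = f s`_i.
  have [lt_i|ge_i] := ltnP i (size s); first by rewrite (nth_map 0).
  by rewrite !nth_default // size_map.
exists (map f s); split=> [i|u Iu].
  by rewrite nth_f; have /submodule_predP := submod_valP s`_i.
have u_in : (u : R^o) \in submodule_pred idI by apply/submodule_predP.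
have [c] := gen_s (Submod u_in).
move=> /(congr1 f); rewrite /f /= => uE.
exists (fun i => c (cast_ord (size_map f s) i)).
rewrite uE.
have -> : forall n (g : 'I_n -> submod_of (submodule_pred idI)),
    submod_val (\sum_i g i) = \sum_i submod_val (g i).
  by move=> n g; exact: (raddf_sum (val : {linear _ -> R^o})).
rewrite (reindex (cast_ord (size_map f s))) /=; last first.
  by apply: onW_bij; exists (cast_ord (esym (size_map f s)));
    [exact: cast_ordK | exact: cast_ordKV].
by apply: eq_bigr => i _; rewrite nth_f.
Qed.

(** A counterexample without larger counterexamples exists, since otherwise
    dependent choice gives a strictly increasing chain of ideals, whose union
    is not finitely generated. *)
Lemma noetherian_ind (P : (R -> Prop) -> Prop) :
    (forall I, ideal I ->
       (forall J, ideal J -> (forall u, I u -> J u) -> (exists2 u, J u & ~ I u) ->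
          P J) -> P I) ->
  forall I, ideal I -> P I.
Proof.
move=> stepP I0 idI0; apply: contrapT => nPI0.
pose T := {I : R -> Prop | ideal I /\ ~ P I}.
have /choice[f fP] : forall X : T, exists Y : T,
    (forall u, projT1 X u -> projT1 Y u) /\ exists2 u, projT1 Y u & ~ projT1 X u.
  move=> [I [idI nPI]]; apply: contrapT => nY; apply: (nPI).
  apply: stepP => // J idJ IJ uJ.
  by apply: contrapT => nPJ; apply: nY; exists (exist _ J (conj idJ nPJ)).
pose C n := projT1 (iter n f (exist _ I0 (conj idI0 nPI0) : T)).
have idC n : ideal (C n) by rewrite /C; case: (iter _ _ _) => ? [].
have leC i j : (i <= j)%N -> forall u, C i u -> C j u.
  move/subnK <-; elim: (j - i)%N => // k IH u /IH; exact: (fP _).1.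
have [] := @ideal_fg (fun u => exists n, C n u).
  split; first by exists 0; exact: submodule0 (idC 0).
  move=> a u v [i Ci] [j Cj]; exists (maxn i j).
  apply: (idC _).2; first by apply: leC Ci; exact: leq_maxl.
  by apply: leC Cj; exact: leq_maxr.
move=> s [/choice[n sC] gen_s].
pose N := \max_i n i.
have [u uC nuC] := (fP (iter N f (exist _ I0 (conj idI0 nPI0) : T))).2.
apply: nuC; have [|c ->] := gen_s u; first by exists N.+1.
apply: (submodule_sum (idC N)) => i; apply: idealM => //.
by apply: leC (sC i); exact: leq_bigmax.
Qed.

Lemma local_prime_le (m : idealr R) : local_ring m ->
  forall J : idealr R, {subset J <= m}.
Proof.
move=> [_ m_uniq] J0; suff: forall I, ideal I -> ~ I 1 -> forall u, I u -> u \in m.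
  move=> /(_ _ (ideal_mem J0)); apply; by rewrite idealr1.
apply: noetherian_ind => I idI IH I1 u Iu.
have [J JI] := ideal_idealr idI I1.
have [/m_uniq <-|] := pselect (maximal_ideal J); first exact/JI.
move=> /existsNP[J' /not_implyP[JJ' neJ]].
apply: (IH _ (ideal_mem J')); last exact/JJ'/JI.
- by move=> v Iv; exact/JJ'/JI.
- apply: contrapT => nJ; apply: neJ => v; apply/idP/idP; last exact: JJ'.
  by move=> J'v; apply/JI; apply: contrapT => nIv; apply: nJ; exists v.
- by rewrite idealr1.
Qed.

Lemma maximal_prime (m : idealr R) : maximal_ideal m ->
  exists q, q =i m.
Proof.
move=> m_max; have [||a b abm|q qm] := @ideal_prime R (fun u => u \in m).
- exact: ideal_mem.
- by rewrite idealr1.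
- have [am|/negP am] := boolP (a \in m); [by left | right].
  have idJ := ideal_adjoin_ideal a (ideal_mem m).
  have [[v [r [vm /(congr1 ( *%R b)) e]]]|J1] :=
    pselect (ideal_adjoin (fun u => u \in m) a 1).
    by rewrite -[b]mulr1 e mulrDr mulrCA rpredD //; apply: idealMr => //;
      rewrite mulrC.
  have [J JE] := ideal_idealr idJ J1.
  case: am; rewrite -(m_max J) => [|v vm]; first exact/JE/ideal_adjoinr/ideal_mem.
  exact/JE/ideal_adjoinl.
- by exists q => u; apply/idP/idP => /qm.
Qed.

(** If [p] is minimal over [I0], the local ring at [p] modulo [I0] is
    Artinian. By Noetherian induction on [I], the claim is reduced to the case
    where [I] is prime: if [a * b] is in [I] and neither factor is, the chains
    of saturations of [J n + (a)] and of [(J n : a)] contain the strictly larger ideals [I + (a)]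
    and [I + (b)] and so become stationary, and these two chains together
    determine [J n]. If [I] is prime and contained in [p] then [I = p], and a
    saturated ideal that contains [p] is [p] or the whole ring. *)
Lemma dcc_saturated p I0 :
    (forall q, (forall u, I0 u -> u \in q) -> {subset q <= p} ->
       {subset p <= q}) ->
  forall I, ideal I -> (forall u, I0 u -> I u) ->
  forall J : nat -> R -> Prop,
    (forall n, ideal (J n)) -> (forall n, saturated p (J n)) ->
    (forall n u, J n.+1 u -> J n u) -> (forall n u, I u -> J n u) ->
  exists N, forall n, (N <= n)%N -> forall u, J n u -> J n.+1 u.
Proof.
move=> p_min; apply: noetherian_ind => I idI IH I0I J idJ satJ decJ IJ.
have full n w : J n w -> w \notin p -> forall u, J n u.
  by move=> Jw wp u; apply: (satJ n w) => //; rewrite mulrC; apply: idealM.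
have [[w Iw wp]|Ip] := pselect (exists2 w, I w & w \notin p).
  by exists 0%N => n _ u _; apply: (full _ w) => //; exact: IJ.
have {}Ip u : I u -> u \in p.
  by move=> Iu; apply: contrapT => /negP up; apply: Ip; exists u.
have [prI|] := pselect (forall a b, I (a * b) -> I a \/ I b).
  (* [I] is then a prime between [I0] and [p], hence equal to [p]. *)
  have [|q qI] := ideal_prime idI _ prI; first by move=> /Ip; rewrite idealr1.
  have pq : {subset p <= q} by apply: p_min => u => [/I0I|] /qI // /Ip.
  have [[N JN]|nJp] := pselect (exists N, forall u, J N u -> u \in p).
    exists N => n leNn u Ju; apply: IJ; apply/qI/pq/JN.
    by move: Ju; rewrite -(subnK leNn); elim: (n - N)%N => // k IHk /decJ.
  exists 0%N => n _ u _; apply: contrapT => nJ; apply: nJp; exists n.+1 => w Jw.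
  by apply: contrapT => /negP wp; apply: nJ; apply: full Jw wp _.
move=> /existsNP[a /existsNP[b /not_implyP[Iab /not_orP[nIa nIb]]]].
have [] := IH _ (ideal_adjoin_ideal a idI) _ _ _
  (fun n => saturation p (ideal_adjoin (J n) a)).
- by move=> u; exact: ideal_adjoinl.
- by exists a => //; exact: ideal_adjoinr.
- by move=> u /I0I; exact: ideal_adjoinl.
- by move=> n; apply/saturation_ideal/ideal_adjoin_ideal.
- by move=> n; exact: saturation_saturated.
- by move=> n u [s sp [v [r [/decJ Jv e]]]]; exists s => //; exists v, r.
- move=> n _ [v [r [Iv ->]]]; apply: saturation_id; exists v, r.
  by split=> //; exact: IJ.
move=> N1 stab1.
have [] := IH _ (ideal_adjoin_ideal b idI) _ _ _ (fun n u => J n (u * a)).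
- by move=> u; exact: ideal_adjoinl.
- by exists b => //; exact: ideal_adjoinr.
- by move=> u /I0I; exact: ideal_adjoinl.
- by move=> n; apply: ideal_colon.
- by move=> n; exact: colon_saturated.
- by move=> n u; exact: decJ.
- move=> n _ [v [r [Iv ->]]]; rewrite mulrDl -mulrA [b * a]mulrC.
  by apply: (submoduleD (idJ n)); [rewrite mulrC|]; apply: idealM => //; apply: IJ.
move=> N2 stab2; exists (maxn N1 N2) => n; rewrite geq_max => /andP[le1 le2] u Ju.
have [s sp [v [r [Jv e]]]] : saturation p (ideal_adjoin (J n.+1) a) u.
  by apply: stab1 => //; apply: saturation_id; exact: ideal_adjoinl.
apply: (satJ _ s) => //; rewrite e; apply: (submoduleD (idJ _)) => //.
apply: stab2 => //; rewrite -(addKr v (r * a)) -e addrC.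
apply: (submoduleB (idJ n)); [exact: idealM | exact: decJ].
Qed.

(** Krull's principal ideal theorem in the domain [R / p0]: [p2] has height at
    least two there, so it is not minimal over [x]. Suppose it were, with [x]
    not in [p1], and pick [y] in [p1] outside [p0]. Let [Q n] be the
    contraction of the ideal [(y ^ n) + p0] of the local ring at [p1]. The
    ideals [Q n + (x)] become stationary at [p2] by [dcc_saturated]; since [x]
    is not in [p1], [r * x] in [Q n] forces [r] in [Q n], so this reads
    [Q N = Q N.+1 + x (Q N)] locally at [p2], and Nakayama's lemma gives
    [Q N = Q N.+1]. Hence [w * y ^ N] is in [(y ^ N.+1) + p0] for some [w]
    outside [p1], which puts [y] in [p0] or [w] in [p1]. *)
Lemma krull_height_two p0 p1 p2 x :
    prime_lt p0 p1 -> prime_lt p1 p2 -> x \in p2 ->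
  exists q, [/\ prime_lt p0 q, prime_lt q p2 & x \in q].
Proof.
move=> lt01 lt12 xp2.
have [xp1|xp1] := boolP (x \in p1); first by exists p1.
have [s01 /existsNP[y /not_implyP[yp1 /negP yp0]]] := lt01.
have s12 := lt12.1.
apply: contrapT => no_q.
have p2_min q : (forall u, ideal_adjoin (fun u => u \in p0) x u -> u \in q) ->
    {subset q <= p2} -> {subset p2 <= q}.
  move=> p0xq qp2; apply: contrapT => np2q; apply: no_q; exists q.
  have xq : x \in q by apply/p0xq/ideal_adjoinr/ideal_mem.
  split=> //; split=> [u up0|/(_ x xq) /s01]; first exact/p0xq/ideal_adjoinl.
  exact/negP.
pose Q n := saturation p1 (ideal_adjoin (fun u => u \in p0) (y ^+ n)).
have idQ n : ideal (Q n) by apply/saturation_ideal/ideal_adjoin_ideal/ideal_mem.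
have decQ n u : Q n.+1 u -> Q n u.
  move=> [s sp [v [r [vp e]]]]; exists s => //; exists v, (r * y).
  by rewrite -mulrA -exprS.
have satQ n : saturated p1 (Q n) by exact: saturation_saturated.
have [] := dcc_saturated p2_min (ideal_adjoin_ideal x (ideal_mem p0)) (fun _ => id)
  (J := fun n => saturation p2 (ideal_adjoin (Q n) x)).
- by move=> n; apply/saturation_ideal/ideal_adjoin_ideal.
- by move=> n; exact: saturation_saturated.
- by move=> n u [s sp [v [r [/decQ Qv e]]]]; exists s => //; exists v, r.
- move=> n _ [v [r [vp ->]]]; apply: saturation_id; exists v, r; split=> //.
  by apply: saturation_id; exact: ideal_adjoinl.
move=> N /(_ N (leqnn N)) stab.
have [s [Qs gen_s]] := ideal_fg (idQ N).
have [] := @local_nakayama R p2 (R^o : lmodType R) (Q N.+1) s (idQ N.+1).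
  move=> i; have [|t tp [v [r [Qv e]]]] := stab s`_i.
    by apply: saturation_id; exact: ideal_adjoinl.
  have Qr : Q N r.
    apply: (satQ _ x) => //; rewrite mulrC -(addKr v (r * x)) -e addrC.
    by apply: (submoduleB (idQ N)); [exact: idealM | exact: decQ].
  have [c rE] := gen_s r Qr.
  exists t, (fun j => c j * x); split=> // [j|]; first exact: idealMr.
  have -> : \sum_j (c j * x) *: (s`_j : R^o) = r * x.
    rewrite rE mulr_suml; apply: eq_bigr => j _.
    by rewrite /GRing.scale /= mulrAC.
  by rewrite /GRing.scale /= e addrK.
move=> t tp2 Qts.
(* [t] is outside [p2], hence outside [p1], and [Q N.+1] is saturated at [p1]. *)
have QN : Q N.+1 (y ^+ N).
  have [|c ->] := gen_s (y ^+ N).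
    by apply: saturation_id; exact: ideal_adjoinr (ideal_mem p0).
  apply: (submodule_sum (idQ _)) => i; apply: idealM => //.
  by apply: (satQ _ t) (Qts i); apply: contra tp2; exact: s12.
have [w wp1 [v [r [vp0]]]] := QN.
rewrite exprS mulrA => /eqP; rewrite -subr_eq -mulrBl => /eqP e.
have : (w - r * y) * y ^+ N \in p0 by rewrite e.
rewrite prime_idealrM => /orP[/s01 wr|].
  by case/negP: wp1; rewrite -[w](subrK (r * y)) rpredD // idealMr.
by elim: (N) => [|k IHk]; rewrite ?idealr1 // exprS prime_idealrM (negPf yp0).
Qed.

(** Starting from the top, two consecutive steps [p n < p n.+1 < p n.+2] with
    [x] in the last prime can be replaced by [p n < r < p n.+2] with [x] in
    [r]; this moves the entrance of [x] down to the second prime. Including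
    [x] costs one step of the chain. *)
Lemma prime_chain_through (x : R) n (p : nat -> prime_idealr R) :
    (forall i, (i <= n)%N -> prime_lt (p i) (p i.+1)) -> x \in p n.+1 ->
  exists q : nat -> prime_idealr R,
    [/\ x \in q 0%N, {subset p 0%N <= q 0%N}, {subset q n <= p n.+1} &
        forall i, (i < n)%N -> prime_lt (q i) (q i.+1)].
Proof.
elim: n p => [|n IHn] p lt_p xp.
  by exists (fun=> p 1%N); split=> //; exact: (lt_p 0 _).1.
have [r [lt_nr lt_rn xr]] :=
  krull_height_two (lt_p n (leqnSn n)) (lt_p _ (leqnn _)) xp.
pose p' i := if i == n.+1 then r else p i.
have [||q [xq pq qr lt_q]] := IHn p'.
- move=> i le_in; rewrite /p' eqSS ltn_eqF //; have [->//|_] := eqP.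
  by apply: lt_p; exact: leqW.
- by rewrite /p' eqxx.
exists (fun i => if i == n.+1 then p n.+2 else q i); split=> // [|i].
  by rewrite eqxx.
rewrite ltnS eqSS => le_in; rewrite ltn_eqF //; have [->|ne_in] := eqP.
  move: qr; rewrite /p' eqxx => qr; split=> [u /qr /(lt_rn.1)|sub] //.
  by case: lt_rn => _; apply=> u /sub /qr.
by apply: lt_q; rewrite ltn_neqAle le_in andbT; exact/eqP.
Qed.

End Noetherian.

(** * Quotient modules, Serre classes and finite length *)

Section Linear.
Variable R : comNzRingType.
Implicit Types L M N : lmodType R.

Lemma linear_fun M N (f : M -> N) : linear f ->
  exists g : {linear M -> N}, g =1 f.
Proof.
move=> lin_f.
pose fL := GRing.isLinear.Build R M N *:%R f lin_f.
pose g : {linear M -> N} := HB.pack f fL.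
by exists g.
Qed.

Lemma quotmod_linear M (N : submodClosed M) :
  exists f : {linear M -> quotmod N}, f =1 @quotmod_pi R M N.
Proof.
apply: linear_fun => a u v; rewrite quotmod_piD; congr (_ + _).
by rewrite -[_ *: quotmod_pi _ _]/(quotmod_scale _ _) quotmod_scale_pi.
Qed.

Lemma quotmod_piZ M (N : submodClosed M) a u :
  quotmod_pi N (a *: u) = a *: quotmod_pi N u.
Proof. by rewrite -[RHS]/(quotmod_scale _ _) quotmod_scale_pi. Qed.

Lemma quotmod_pi_eq0 M (N : submodClosed M) u :
  quotmod_pi N u = 0 <-> u \in N.
Proof.
have [f fE] := quotmod_linear N.
by rewrite -[0](linear0 f) fE quotmod_piE subr0.
Qed.

Lemma quotmod_lift M L (N : submodClosed M) (f : {linear M -> L}) :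
    (forall u, u \in N -> f u = 0) ->
  exists g : {linear quotmod N -> L}, forall u, g (quotmod_pi N u) = f u.
Proof.
move=> fN0; have [repr reprE] : exists r : quotmod N -> M,
    forall u, quotmod_pi N (r u) = u.
  have /choice[r rE] := @quotmod_piP R M N.
  by exists r => u; rewrite -rE.
have fr u : f (repr (quotmod_pi N u)) = f u.
  apply/subr0_eq; rewrite -linearB fN0 //; exact/quotmod_piE.
have [|g gE] := @linear_fun (quotmod N) L (fun u => f (repr u)).
  move=> a u v; have [u' ->] := quotmod_piP u; have [v' ->] := quotmod_piP v.
  by rewrite -quotmod_piZ -quotmod_piD !fr linearP.
by exists g => u; rewrite gE.
Qed.

Lemma submod_val_inj M (N : submodClosed M) : injective (@submod_val R M N).
Proof. exact: val_inj. Qed.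

Lemma submod_val_linear M (N : submodClosed M) :
  exists f : {linear submod_of N -> M}, f =1 @submod_val R M N.
Proof. by exists (val : {linear submod_of N -> M}). Qed.

Lemma submodule_preim M N (f : {linear M -> N}) (K : submodClosed N) :
  submodule (fun u => f u \in K).
Proof.
by split=> [|a u v fu fv]; rewrite ?linear0 ?rpred0 // linearP rpredD ?rpredZ.
Qed.

Definition preim_submod M N (f : {linear M -> N}) (K : submodClosed N) :
  submodClosed M := submodule_pred (submodule_preim f K).

Lemma mem_preim_submod M N (f : {linear M -> N}) (K : submodClosed N) u :
  (u \in preim_submod f K) = (f u \in K).
Proof. by apply/idP/idP => /(submodule_predP (submodule_preim f K)). Qed.

Lemma submodule_im M N (f : {linear M -> N}) (K : M -> Prop) : submodule K ->
  submodule (fun v => exists2 u, K u & f u = v).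
Proof.
move=> subK; split; first by exists 0; rewrite ?linear0 //; case: subK.
move=> a _ _ [u Ku <-] [v Kv <-]; exists (a *: u + v); rewrite ?linearP //.
exact: subK.2.
Qed.

Section Serre.
Variables (S : lmodType R -> Prop) (S_serre : serre_class S).

Lemma serre_quot M N (g : {linear M -> N}) :
  (forall v, exists u, g u = v) -> S M -> S N.
Proof.
move=> g_surj SM.
have subK : submodule (fun u => g u = 0).
  by split=> [|a u v gu gv]; rewrite ?linear0 // linearP gu gv scaler0 addr0.
have [f fE] := submod_val_linear (submodule_pred subK).
have fg : short_exact f g.
  split=> // [u v|u]; first by rewrite !fE => /submod_val_inj.
  split=> [gu|[w <-]]; last by rewrite fE; have /submodule_predP := submod_valP w.
  by have uK := (submodule_predP subK u).2 gu; exists (Submod uK); rewrite fE.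
by have [/(_ SM)[]] := S_serre.2 _ _ _ f g fg.
Qed.

Lemma serre_sub L M (f : {linear L -> M}) : injective f -> S M -> S L.
Proof.
move=> f_inj SM.
have subI : submodule (fun u => exists2 w, True & f w = u).
  by apply: submodule_im.
have [g gE] := quotmod_linear (submodule_pred subI).
have fg : short_exact f g.
  split=> // [v|u]; first by have [u ->] := quotmod_piP v; exists u.
  rewrite gE; split=> [/quotmod_pi_eq0/submodule_predP[w _ <-]|[w <-]].
    by exists w.
  by apply/quotmod_pi_eq0/submodule_predP; exists w.
by have [/(_ SM)[]] := S_serre.2 _ _ _ f g fg.
Qed.

(** A surjection between the subquotients is all that a Serre class needs, so
    that isomorphic subquotients can be exchanged without an inverse map. *)
Lemma serre_subquot M N (g : {linear M -> N})
    (K K0 : submodClosed M) (L L0 : submodClosed N) :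
    (forall u, u \in K -> g u \in L) ->
    (forall u, u \in K0 -> g u \in L0) ->
    (forall v, v \in L -> exists2 u, u \in K & g u = v) ->
  S (subquot K K0) -> S (subquot L L0).
Proof.
move=> gKL gKL0 g_surj.
have [h hE] : exists h : {linear submod_of K -> submod_of L},
    forall w, submod_val (h w) = g (submod_val w).
  pose h w := Submod (gKL _ (submod_valP w)).
  have [|h' h'E] := @linear_fun (submod_of K) (submod_of L) h.
    move=> a u v; apply: submod_val_inj.
    have [f' fE'] := submod_val_linear L.
    by rewrite -[RHS]fE' linearP !fE' /= -linearP.
  by exists h' => w; rewrite h'E.
have [pi piE] := quotmod_linear (@subpreim _ _ L L0).
have [|f fE] := @quotmod_lift _ _ (@subpreim _ _ K K0) (pi \o h).
  move=> w wK0; rewrite /= piE; apply/quotmod_pi_eq0.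
  by rewrite inE hE; exact: gKL0.
apply: (@serre_quot _ _ f) => v; have [w ->] := quotmod_piP v.
have [u uK gu] := g_surj _ (submod_valP w).
exists (quotmod_pi _ (Submod uK)); rewrite fE /= piE; congr quotmod_pi.
by apply: submod_val_inj; rewrite hE.
Qed.

(** The multiples of [u] form a copy of [R / p]. *)
Lemma serre_cyclic M (p : idealr R) (u : M) :
  (forall a, a *: u = 0 <-> a \in p) -> S M -> S (ring_mod p).
Proof.
move=> ann_u; have [|h hE] := @linear_fun (R^o) M (fun a => a *: u).
  by move=> a b c; rewrite scalerDl scalerA.
have [a ap|f fE] := @quotmod_lift _ _ (ideal_pred p) h.
  by rewrite hE; exact/ann_u.
apply: (@serre_sub _ _ f) => v w.
have [v' ->] := quotmod_piP v; have [w' ->] := quotmod_piP w.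
rewrite !fE !hE => /eqP; rewrite -subr_eq0 -scalerBl => /eqP/ann_u.
by move=> vw; apply/quotmod_piE.
Qed.

End Serre.

Lemma covers_preim M N (f : {linear M -> N}) (K L : submodClosed N) :
    (forall v, exists u, f u = v) -> covers K L ->
  covers (preim_submod f K) (preim_submod f L).
Proof.
move=> f_surj [KL nLK maxKL]; split.
- by move=> u; rewrite !mem_preim_submod; exact: KL.
- move=> LK; apply: nLK => v; have [u <-] := f_surj v.
  by rewrite -!mem_preim_submod; exact: LK.
move=> X KX XL.
have subI := submodule_im f (submodule_mem X).
have XE u : (u \in X) = (f u \in submodule_pred subI).
  apply/idP/idP => [uX|/submodule_predP[w wX fw]].
    by apply/submodule_predP; exists u.
  rewrite -(subrK w u) addrC rpredD //; apply: KX.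
  by rewrite mem_preim_submod linearB fw subrr rpred0.
have [v||XK|XL'] := maxKL (submodule_pred subI).
- have [u <-] := f_surj v => fu; rewrite -XE.
  by apply: KX; rewrite mem_preim_submod.
- by move=> _ /submodule_predP[u /XL fu <-]; rewrite -mem_preim_submod.
- by left=> u; rewrite XE XK mem_preim_submod.
- by right=> u; rewrite XE XL' mem_preim_submod.
Qed.

Lemma finite_length_iso M N (f : {linear M -> N}) :
    injective f -> (forall v, exists u, f u = v) ->
  finite_length N -> finite_length M.
Proof.
move=> f_inj f_surj [n [K [K0 Kn coverK]]].
exists n, (fun i => preim_submod f (K i)); split.
- move=> u; rewrite mem_preim_submod K0 !inE -(linear0 f).
  exact: (inj_eq f_inj).
- by move=> u; rewrite mem_preim_submod Kn.
- by move=> i /coverK; exact: covers_preim.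
Qed.

End Linear.

(** * Quotients by the submodules generated by a sequence *)

Section SeqMul.
Variables (R : comNzRingType) (M : lmodType R).

Lemma seqmul_nilP u : u \in seqmul M [::] <-> u = 0.
Proof.
split=> [/asboolP[f ->]|->]; last exact: rpred0.
by rewrite big_ord0.
Qed.

Lemma seqmul_consP x xs u : u \in seqmul M (x :: xs) <->
  exists v w, w \in seqmul M xs /\ u = x *: v + w.
Proof.
split=> [/asboolP[f ->]|[v [w [/asboolP[f ->] ->]]]].
  exists (f ord0), (\sum_(i < size xs) xs`_i *: f (lift ord0 i)).
  by split; [apply/asboolP; exists (fun i => f (lift ord0 i)) | rewrite big_ord_recl].
apply/asboolP; exists (fun i => if unlift ord0 i is Some j then f j else v).
rewrite big_ord_recl /= unlift_none; congr (_ + _).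
by apply: eq_bigr => i _; rewrite liftK.
Qed.

Lemma seqmul1P x u : u \in seqmul M [:: x] <-> exists v, u = x *: v.
Proof.
rewrite seqmul_consP; split=> [[v [w [/seqmul_nilP-> ->]]]|[v ->]]; exists v.
  by rewrite addr0.
by exists 0; rewrite addr0; split=> //; exact/seqmul_nilP.
Qed.

Lemma seqmul_quotP x xs u :
  quotmod_pi (seqmul M [:: x]) u \in seqmul (quotmod (seqmul M [:: x])) xs <->
  u \in seqmul M (x :: xs).
Proof.
set N := seqmul M [:: x].
have [pi piE] := quotmod_linear N.
have pi_sum n (a : 'I_n -> R) (f : 'I_n -> M) :
    quotmod_pi N (\sum_i a i *: f i) = \sum_i a i *: quotmod_pi N (f i).
  by rewrite -piE linear_sum; apply: eq_bigr => i _; rewrite linearZ_LR -?piE.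
split=> [/asboolP[g e]|/seqmul_consP[v [w [/asboolP[f ->] ->]]]].
  have /choice[f fE] := fun i => quotmod_piP (g i).
  have /quotmod_piE/seqmul1P[v vE] : quotmod_pi N u =
      quotmod_pi N (\sum_(i < size xs) xs`_i *: f i).
    by rewrite pi_sum e; apply: eq_bigr => i _; rewrite fE.
  apply/seqmul_consP; exists v, (\sum_(i < size xs) xs`_i *: f i).
  by split; [apply/asboolP; exists f | rewrite -vE subrK].
apply/asboolP; exists (fun i => quotmod_pi N (f i)); rewrite -pi_sum.
by apply/quotmod_piE; rewrite addrK; apply/seqmul1P; exists v.
Qed.

Lemma fin_gen_quot (N : submodClosed M) : fin_gen M -> fin_gen (quotmod N).
Proof.
have [pi piE] := quotmod_linear N.
move=> [s gen_s]; exists (map pi s) => v; have [u ->] := quotmod_piP v.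
have [c uE] := gen_s u; exists (fun i => c (cast_ord (size_map pi s) i)).
rewrite -piE uE linear_sum (reindex (cast_ord (size_map pi s))) /=; last first.
  apply: onW_bij; exists (cast_ord (esym (size_map pi s))).
    exact: cast_ordK.
  exact: cast_ordKV.
apply: eq_bigr => i _; rewrite linearZ_LR (nth_map 0) //.
by rewrite -(size_map pi).
Qed.

Lemma weak_seq_quot (S : lmodType R -> Prop) x xs :
    serre_class S -> weak_seq S M (x :: xs) ->
  weak_seq S (quotmod (seqmul M [:: x])) xs.
Proof.
move=> S_serre weak_xs i lt_i; have := weak_xs i.+1 lt_i.
have [pi piE] := quotmod_linear (seqmul M [:: x]).
have colonE u :
    (pi u \in colon (seqmul (quotmod (seqmul M [:: x])) (take i xs)) xs`_i) =
    (u \in colon (seqmul M (x :: take i xs)) xs`_i).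
  by rewrite !inE -linearZ_LR piE; apply/idP/idP => /seqmul_quotP.
apply: (serre_subquot S_serre (g := pi)) => [u|u|v].
- by rewrite colonE.
- by rewrite piE => /seqmul_quotP.
- by have [u ->] := quotmod_piP v; rewrite -piE colonE; exists u.
Qed.

Lemma finite_length_quot x xs :
    finite_length (quotmod (seqmul (quotmod (seqmul M [:: x])) xs)) ->
  finite_length (quotmod (seqmul M (x :: xs))).
Proof.
set N := seqmul M [:: x]; set N' := seqmul (quotmod N) xs.
have [pi piE] := quotmod_linear N; have [pi' pi'E] := quotmod_linear N'.
have [u /seqmul_quotP uN|f fE] :=
  @quotmod_lift _ _ _ (seqmul M (x :: xs)) (pi' \o pi).
  by rewrite /= piE pi'E; apply/quotmod_pi_eq0.
apply: (finite_length_iso (f := f)) => [v w|v].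
  have [v' ->] := quotmod_piP v; have [w' ->] := quotmod_piP w.
  rewrite !fE /= => /eqP; rewrite -subr_eq0 -!linearB /= pi'E => /eqP.
  by move=> /quotmod_pi_eq0; rewrite piE => /seqmul_quotP/quotmod_piE.
have [w ->] := quotmod_piP v; have [u ->] := quotmod_piP w.
by exists (quotmod_pi _ u); rewrite fE /= piE pi'E.
Qed.

End SeqMul.

(** * Supports and dimension *)

Section Support.
Variable R : comNzRingType.
Implicit Types (M : lmodType R) (p q : prime_idealr R).

Lemma suppP M p :
  supp M p <-> exists u : M, forall w, w *: u = 0 -> w \in p.
Proof.
split=> [[u [s [sp nfrac]]]|[u ann_u]].
  exists u => w wu; apply: contrapT => /negP wp; apply: nfrac.
  by exists w => //; rewrite scale1r scaler0 subr0.
exists u, 1; split=> [|[w /negP wp]]; first exact: notin_prime1.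
by rewrite scale1r scaler0 subr0 => /ann_u.
Qed.

Lemma supp_le M p q : supp M p -> {subset p <= q} -> supp M q.
Proof.
by move=> /suppP[u ann_u] pq; apply/suppP; exists u => w /ann_u/pq.
Qed.

Lemma supp_quot M (N : submodClosed M) p : supp (quotmod N) p -> supp M p.
Proof.
move=> /suppP[v]; have [u ->] := quotmod_piP v => ann_u; apply/suppP.
exists u => w wu; apply: ann_u.
by rewrite -quotmod_piZ wu; apply/quotmod_pi_eq0; rewrite rpred0.
Qed.

Lemma supp_quot_mem M x p : supp (quotmod (seqmul M [:: x])) p -> x \in p.
Proof.
move=> /suppP[v]; have [u ->] := quotmod_piP v; apply.
by rewrite -quotmod_piZ; apply/quotmod_pi_eq0/seqmul1P; exists u.
Qed.

Lemma supp_ring_mod (p : idealr R) q : supp (ring_mod p) q -> {subset p <= q}.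
Proof.
move=> /suppP[v]; have [u ->] := quotmod_piP v => ann_u a ap; apply: ann_u.
rewrite -quotmod_piZ; apply/quotmod_pi_eq0.
by rewrite inE /GRing.scale /= mulrC idealMr.
Qed.

(** Otherwise each generator of [M] lies in [xM] after localizing at [p], and
    Nakayama's lemma makes the localization of [M] vanish. *)
Lemma supp_quot_fg M x p :
  fin_gen M -> supp M p -> x \in p -> supp (quotmod (seqmul M [:: x])) p.
Proof.
move=> [s gen_s] /suppP[u ann_u] xp; apply: contrapT => nsupp.
have [] := @local_nakayama R p M (fun v => v = 0) s (@submodule_eq0 R M).
  move=> i.
  have [w wp] : exists2 w, w \notin p & w *: s`_i \in seqmul M [:: x].
    apply: contrapT => nw; apply: nsupp; apply/suppP.
    exists (quotmod_pi _ s`_i) => w; rewrite -quotmod_piZ => /quotmod_pi_eq0 ws.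
    by apply: contrapT => /negP wp; apply: nw; exists w.
  move=> /seqmul1P[v]; have [c ->] := gen_s v => e.
  exists w, (fun j => c j * x); split=> // [j|]; first exact: idealMr.
  rewrite e scaler_sumr; apply/eqP; rewrite subr_eq0; apply/eqP.
  by apply: eq_bigr => j _; rewrite scalerA mulrC.
move=> t /negP tp ts0; apply/tp/ann_u; have [c ->] := gen_s u.
by rewrite scaler_sumr big1 // => i _; rewrite scalerA mulrC -scalerA ts0 scaler0.
Qed.

Lemma krull_dimP M n : krull_dim M = n%:E <->
  supp_chain M n /\ forall k, supp_chain M k -> (k <= n)%N.
Proof.
rewrite /krull_dim; case: pselect => [e|ne].
  case: (cid e) => d [chain_d max_d] /=; split=> [[<-]//|[chain_n max_n]].
  by congr (_%:E); apply/anti_leq/andP; split; [exact: max_n | exact: max_d].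
by split=> [|chain_n]; [case: ifP | case: ne; exists n].
Qed.

Section Noetherian.
Hypothesis R_noeth : noetherian R.

(** Since every prime lies in [m], the top of the chain can be taken to be
    [m], which contains [x]; then the chain is rerouted through [x]. *)
Lemma supp_chain_quot (m : idealr R) M x n :
    local_ring m -> fin_gen M -> x \in m -> supp_chain M n.+1 ->
  supp_chain (quotmod (seqmul M [:: x])) n.
Proof.
move=> R_local M_fg xm [p [supp_p lt_p]].
have [m' m'E] := maximal_prime R_local.1.
pose p' i := if i == n.+1 then m' else p i.
have [||q [xq p0q _ lt_q]] := @prime_chain_through R R_noeth x n p'.
- move=> i le_in; rewrite /p' ltn_eqF //; have [[->]|_] := eqVneq; last exact: lt_p.
  have [_ nsub] := lt_p n (leqnn _).
  have le_m (J : idealr R) : {subset J <= m'}.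
    by move=> a; rewrite m'E; exact: (local_prime_le R_noeth R_local).
  by split=> [|sub]; [exact: le_m | apply: nsub => a /le_m/sub].
- by rewrite /p' eqxx m'E.
have le_q i : (i <= n)%N -> {subset q 0%N <= q i}.
  elim: i => [_ a //|i IHi lt_in a /(IHi (ltnW lt_in))]; exact: (lt_q i lt_in).1.
exists q; split=> // i le_in; apply: supp_quot_fg => //; last exact: le_q.
by apply: supp_le (supp_p 0%N _) _ => // a /p0q; exact: le_q.
Qed.

Lemma supp_chain_cons M p n : supp_chain (ring_mod p) n ->
    (exists2 q, supp M q & prime_lt q p) ->
  supp_chain M n.+1.
Proof.
move=> [c [supp_c lt_c]] [q supp_q [qp npq]].
have pc i : (i <= n)%N -> {subset p <= c i} by move=> /supp_c; exact: supp_ring_mod.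
exists (fun i => if i is j.+1 then c j else q); split=> -[|i] //.
- by move=> le_in; apply: (supp_le supp_q) => a /qp; exact: pc.
- move=> _; split=> [a /qp|sub]; first exact: pc.
  by apply: npq => a /pc/sub; apply.
- exact: lt_c.
Qed.

(** A prime that is minimal in the support is associated. Among the
    annihilators [I u] of nonzero elements of the localization of [M] at [p],
    a maximal one is prime; it is the contraction of a prime of the support
    that is contained in [p], so it is [p]. Multiplying [u] by denominators
    for finitely many generators of [p] gives an element of [M] itself that
    is annihilated by [p]. *)
Lemma supp_minimal_ass M p : supp M p ->
    (forall q, supp M q -> {subset q <= p} -> {subset p <= q}) ->
  exists u : M, forall a, a *: u = 0 <-> a \in p.
Proof.
move=> /suppP[u0 ann_u0] p_min.
pose ann (u : M) (a : R) := a *: u = 0.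
have ann_ideal u : ideal (ann u).
  split=> [|a b c]; rewrite /ann ?scale0r // => bu cu.
  by rewrite scalerDl -[a *: b]/(a * (b : R)) -scalerA bu cu scaler0 addr0.
pose I u := saturation p (ann u).
have idI u : ideal (I u) by exact: saturation_ideal.
have [u prI I1] : exists2 u, forall a b, I u (a * b) -> I u a \/ I u b & ~ I u 1.
  suff: forall J, ideal J -> forall u, (forall a, J a <-> I u a) -> ~ I u 1 ->
      exists2 u, forall a b, I u (a * b) -> I u a \/ I u b & ~ I u 1.
    move/(_ _ (idI u0) u0 (fun=> conj id id)); apply=> -[s /negP sp].
    by rewrite mulr1 => /ann_u0.
  apply: (noetherian_ind R_noeth) => J idJ IH u JE I1.
  have [prI|] := pselect (forall a b, I u (a * b) -> I u a \/ I u b).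
    by exists u.
  move=> /existsNP[a /existsNP[b /not_implyP[Iab /not_orP[nIa nIb]]]].
  have IaE c : I (a *: u) c <-> I u (c * a).
    by split=> -[s sp e]; exists s => //; move: e; rewrite /ann scalerA mulrA.
  (* [a *: u] is nonzero after localizing and has a larger annihilator. *)
  apply: (IH _ (idI (a *: u)) _ _ (a *: u)) => //.
  - move=> c /JE Ic; apply/IaE; rewrite mulrC; exact: idealM.
  - by exists b; [apply/IaE; rewrite mulrC | move/JE].
  - by move/IaE; rewrite mul1r.
have [q qE] := ideal_prime (idI u) I1 prI.
have qp : {subset q <= p}.
  move=> a /qE[s sp sau]; apply: contrapT => /negP ap; apply: I1.
  by exists (s * a); [exact: notin_primeM | rewrite mulr1].
have pI a : a \in p -> I u a.
  have supp_q : supp M q.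
    apply/suppP; exists u => w wu; apply/qE; exact: saturation_id.
  by move=> /(p_min q supp_q qp)/qE.
have [s [s_p gen_s]] := ideal_fg R_noeth (ideal_mem p).
have /choice[t tP] : forall i : 'I_(size s), exists t, t \notin p /\ ann u (t * s`_i).
  by move=> i; have [t tp tu] := pI _ (s_p i); exists t.
pose T := \prod_i t i.
exists (T *: u) => a; split=> [aTu|/gen_s[c ->]].
  apply/qp/qE; exists T; last by rewrite /ann mulrC -scalerA.
  by apply: notin_prime_prod => i; case: (tP i).
rewrite scaler_suml big1 // => i _.
rewrite /T (bigD1 i) //= scalerA.
have -> : c i * s`_i * (t i * \prod_(j | j != i) t j) =
    (c i * \prod_(j | j != i) t j) * (t i * s`_i) by ring.
by rewrite -scalerA (tP i).2 scaler0.
Qed.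

End Noetherian.

End Support.

Theorem proposition3p6 (R : comNzRingType) (m : idealr R)
    (R_noetherian : noetherian R) (R_local : local_ring m)
    (S : lmodType R -> Prop) (S_serre : serre_class S)
    (M : lmodType R) (M_CM : S_CM m S M)
    (x : R) (x_in_m : x \in m) (x_weak : weak_seq S M [:: x])
    (Assh_nonempty : exists p : prime_idealr R,
        S_Assh S (quotmod (seqmul M [:: x])) p) :
  S_CM m S (quotmod (seqmul M [:: x])).
Proof.
have [M_fg M_weak] := M_CM.
split=> [|ys [dim_quot ys_m len_ys]]; first exact: fin_gen_quot.
have [_ max_quot] := (krull_dimP _ _).1 dim_quot.
have [p [[p_supp nSp]]] := Assh_nonempty.
rewrite dim_quot => /krull_dimP[chain_p _].
have le_dim k : supp_chain M k -> (k <= (size ys).+1)%N.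
  case: k => // k /(supp_chain_quot R_noetherian R_local M_fg x_in_m).
  exact: max_quot.
have [dim_M|small_M] := pselect (supp_chain M (size ys).+1).
  apply: weak_seq_quot => //; apply: M_weak; split.
  - exact/krull_dimP.
  - by move=> a; rewrite inE => /orP[/eqP->|/ys_m].
  - exact: finite_length_quot.
case: nSp; have [|u ann_u] := supp_minimal_ass R_noetherian (supp_quot p_supp).
  move=> q supp_q qp; apply: contrapT => npq; apply: small_M.
  by apply: supp_chain_cons chain_p _; exists q.
have xu : u \in colon (seqmul M (take 0 [:: x])) x.
  rewrite inE; apply/seqmul_nilP/ann_u; exact: supp_quot_mem p_supp.
apply: (serre_cyclic S_serre (u := quotmod_pi _ (Submod xu)) _ (x_weak 0%N isT)).
move=> a; rewrite -quotmod_piZ quotmod_pi_eq0 inE.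
exact: iff_trans (seqmul_nilP _) (ann_u a).
Qed.
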